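(* One has $u\sigma(V*V)\subset\ker\zeta^{+}$. That is, $\zeta^{+}\bigl(u\sigma(v*w)\bigr)=0$ for all $v,w\in V$.
   Context: A multi-index is a nonempty finite sequence $\mu=(\mu_1,\ldots,\mu_p)$ of positive integers, of length $l(\mu)=p$ and weight $|\mu|=\sum\mu_i$. $V$ is the $\mathbb{Q}$-vector space with basis the set of all multi-indices. For multi-indices of the same weight write $\nu\ge\mu$ if $\nu$ is a refinement of $\mu$, i.e. $\{\mu_1+\cdots+\mu_k:1\le k<l(\mu)\}\subset\{\nu_1+\cdots+\nu_k:1\le k<l(\nu)\}$. Linear maps $\sigma,u\colon V\to V$ are given by $\sigma(\mu)=(-1)^{l(\mu)}\mu$ and $u(\mu)=\sum_{\nu\ge\mu}\nu$. Harmonic product: for multi-indices $\mu,\nu$, let $\mathcal{H}_{\mu,\nu}$ be the set of all $2\times l$ matrices $M=(m_{ij})$ ($l\ge1$ arbitrary) with non-negative integer entries such that deleting zeros from the first row gives $\mu$, deleting zeros from the second row gives $\nu$, and $m_{1j}+m_{2j}>0$ for all $j$. Put $\mu*\nu=\sum_{M\in\mathcal{H}_{\mu,\nu}}(m_{11}+m_{21},\ldots,m_{1l}+m_{2l})\in V$, extended bilinearly to $V\times V$. $V*V$ denotes the $\mathbb{Q}$-span of all $v*w$ with $v,w\in V$. $\zeta^{+}\colon V\to\mathbb{R}$ is the $\mathbb{Q}$-linear map with $\zeta^{+}(\mu_1,\ldots,\mu_p)=\zeta(\mu_1,\ldots,\mu_{p-1},\mu_p+1)$, where $\zeta(k_1,\ldots,k_p)=\sum_{0<n_1<\cdots<n_p}\frac{1}{n_1^{k_1}\cdots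 n_p^{k_p}}$ for $k_p\ge2$. *)

(* Defs.v *)
From HB Require Import structures.
From mathcomp Require Import all_boot all_order all_algebra finmap.
From mathcomp Require Import boolp classical_sets functions cardinality fsbigop.
From mathcomp Require Import reals ereal esum.
From mathcomp Require Import freeg.

Set Implicit Arguments.
Unset Strict Implicit.
Unset Printing Implicit Defensive.

Import Order.TTheory GRing.Theory Num.Theory.

Local Open Scope classical_set_scope.
Local Open Scope ring_scope.

Definition is_mindex (s : seq nat) : bool :=
  (s != [::]) && all (fun k => 0 < k)%N s.

Record mindex := MIndex { mi_seq :> seq nat; mi_valid : is_mindex mi_seq }.
HB.instance Definition _ := [isSub for mi_seq].
HB.instance Definition _ := [Choice of mindex by <:].

Definition weight (mu : mindex) : nat := sumn mu.

(* coeff mu v is the coefficient of mu in v, and dom v the finite list of those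
   mu whose coefficient is nonzero; fglift is extension by linearity. *)
Definition V := {freeg mindex / rat}.

Definition basis (mu : mindex) : V := Freeg [:: (1 : rat, mu)].

Definition proper_sums (mu : mindex) : set nat :=
  [set sumn (take k mu) | k in [set k | 1 <= k < size mu]%N].

Definition refines (nu mu : mindex) : Prop :=
  weight nu = weight mu /\ proper_sums mu `<=` proper_sums nu.

Definition sigma : V -> V :=
  fglift (fun mu : mindex => (-1) ^+ size mu *: basis mu).

(* The index set is finite (see [finite_refinements]), so this \sum_(_ \in _)
   is the genuine finite sum. *)
Definition u : V -> V :=
  fglift (fun mu : mindex => \sum_(nu \in [set nu | refines nu mu]) basis nu).

(* A 2 x l matrix of natural numbers is encoded as the sequence of its l
   columns, the pair c standing for the column with entries c.1 (first row) and
   c.2 (second row).  The condition l >= 1 follows from mu being nonempty. *)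
Definition in_H (mu nu : mindex) (M : seq (nat * nat)) : bool :=
  [&& [seq m <- [seq c.1 | c <- M] | m != 0%N] == mu,
      [seq m <- [seq c.2 | c <- M] | m != 0%N] == nu
    & all (fun c => 0 < c.1 + c.2)%N M].

Definition H (mu nu : mindex) := {M : seq (nat * nat) | in_H mu nu M}.

Definition column_sums (M : seq (nat * nat)) : seq nat :=
  [seq (c.1 + c.2)%N | c <- M].

Lemma column_sums_mindex (mu nu : mindex) (M : H mu nu) :
  is_mindex (column_sums (val M)).
Proof.
case: M => M /= /and3P[/eqP Mmu _ M_gt0]; apply/andP; split.
  case: M Mmu {M_gt0} => //= mu0.
  by have := mi_valid mu; rewrite -mu0.
by rewrite all_map.
Qed.

Definition contract (mu nu : mindex) (M : H mu nu) : mindex :=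
  MIndex (column_sums_mindex M).

(* As for [u], the index set is finite (see [finite_H]). *)
Definition harmonic_mindex (mu nu : mindex) : V :=
  \sum_(M \in [set: H mu nu]) basis (contract M).

Definition harmonic (v w : V) : V :=
  fglift (fun mu : mindex => fglift (harmonic_mindex mu) w) v.

Definition VstarV : set V :=
  [set x | exists s : seq (rat * V * V),
     x = \sum_(t <- s) t.1.1 *: harmonic t.1.2 t.2].

(* [path ltn 0 n] says 0 < n_1 < ... < n_p.  All terms are nonnegative, so the
   series is a sum over a set in the extended reals; it is finite, and [fine]
   harmless, when k is a multi-index whose last entry is at least 2. *)
Definition zeta (R : realType) (k : seq nat) : R :=
  fine (\esum_(n in [set n : seq nat | size n = size k /\ path ltn 0%N n])
          (\prod_(p <- zip n k) (p.1%:R ^+ p.2)^-1)%:E).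

(* [incr_nth mu (size mu).-1] is (mu_1, ..., mu_(p-1), mu_p + 1). *)
Definition zeta_plus (R : realType) (v : V) : R :=
  \sum_(mu <- dom v) ratr (coeff mu v) * zeta R (incr_nth mu (size mu).-1).

Definition ker_zeta_plus (R : realType) : set V :=
  [set v | zeta_plus R v = 0].

Lemma size_le_sumn (s : seq nat) : all (fun k => 0 < k)%N s ->
  (size s <= sumn s)%N.
Proof.
elim: s => //= k s IHs /andP[k_gt0 /IHs].
by move=> les; rewrite -add1n leq_add.
Qed.

Lemma mem_le_sumn (s : seq nat) (k : nat) : k \in s -> (k <= sumn s)%N.
Proof.
elim: s => //= j s IHs; rewrite inE => /orP[/eqP-> | /IHs le_ks].
  exact: leq_addr.
exact: leq_trans le_ks (leq_addl _ _).
Qed.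

Lemma sumn_filter_neq0 (s : seq nat) :
  sumn [seq m <- s | m != 0%N] = sumn s.
Proof. by elim: s => //= m s <-; case: m. Qed.

Lemma finite_bounded_seq (T : eqType) (r : seq T) (b : nat) :
  finite_set [set s : seq T | (size s <= b)%N /\ {subset s <= r}].
Proof.
elim: b => [|b IHb].
  apply: (sub_finite_set _ (finite_set1 [::])) => s /= [].
  by rewrite leqn0 size_eq0 => /eqP.
apply: (@sub_finite_set _ _ ([set [::]] `|` \bigcup_(x in [set` r])
    (cons x @` [set s : seq T | (size s <= b)%N /\ {subset s <= r}]))).
  case=> [|x s] /= [sz sub]; first by left.
  right; exists x; first by apply: sub; rewrite mem_head.
  exists s => //; split=> // y ys; apply: sub.
  by rewrite inE ys orbT.
rewrite finite_setU; split; first exact: finite_set1.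
apply: bigcup_finite; first exact: finite_seq.
by move=> x _; exact: finite_image.
Qed.

Lemma finite_refinements (mu : mindex) :
  finite_set [set nu | refines nu mu].
Proof.
apply: (@sub_finite_set _ _ (mi_seq @^-1` [set s : seq nat |
    (size s <= weight mu)%N /\ {subset s <= iota 0 (weight mu).+1}])).
  move=> nu [wE _]; split; rewrite -wE.
    by apply: size_le_sumn; case/andP: (mi_valid nu).
  by move=> k kn; rewrite mem_iota add0n ltnS mem_le_sumn.
apply: finite_preimage; last exact: finite_bounded_seq.
by move=> x y _ _; exact: val_inj.
Qed.

Lemma finite_H (mu nu : mindex) : finite_set [set: H mu nu].
Proof.
pose b := (weight mu + weight nu)%N.
apply: (@sub_finite_set _ _ (val @^-1` [set M : seq (nat * nat) |
    (size M <= b)%N /\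
    {subset M <= [seq (i, j) | i <- iota 0 b.+1, j <- iota 0 b.+1]}])).
  case=> M MH _; have /and3P[/eqP M1 /eqP M2 M_gt0] := MH.
  have s1 : sumn [seq c.1 | c <- M] = weight mu.
    by rewrite /weight -M1 sumn_filter_neq0.
  have s2 : sumn [seq c.2 | c <- M] = weight nu.
    by rewrite /weight -M2 sumn_filter_neq0.
  split.
    rewrite /b -s1 -s2 /= => {MH}.
    elim: M M_gt0 {M1 M2 s1 s2} => //= c M IH /andP[c_gt0 /IH leM].
    by rewrite addnACA -add1n leq_add.
  move=> c cM; apply/allpairsP; exists c; rewrite !mem_iota !add0n !ltnS /=.
  split; last by case: c {cM}.
    apply: leq_trans (leq_addr _ _); rewrite -s1.
    by apply: mem_le_sumn; apply/mapP; exists c.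
  apply: leq_trans (leq_addl _ _); rewrite -s2.
  by apply: mem_le_sumn; apply/mapP; exists c.
apply: finite_preimage; last exact: finite_bounded_seq.
by move=> x y _ _; exact: val_inj.
Qed.

(* Main.v *)
(** Let mu = (k_1, ..., k_p); D_mu n N ([mom] below) stands for the moments
    [int s^N (1-s)^n d rho_mu(s)] of a positive measure, given by recursions
    exchanged by s <-> 1 - s.  The Hausdorff moments D_mu 0 N have partial sums
    S_mu(N) = sum_(N >= n_1 >= ... >= n_p >= 1) 1/(n_1^k_1 ... n_p^k_p) ([star]),
    and T_mu(N) = sum_n D_mu n N / (n+1) ([dstar]) plays the role of S_mu'(N),
    as -log s = sum_n (1-s)^(n+1)/(n+1).

    1. Up to the signs (-1)^p the functions S_mu multiply by the harmonic
    product, because both sides satisfy the same difference equation.  The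
    "derivative" of this relation, S_al T_be + T_al S_be = sum of the T_ga, has
    a defect independent of N and tending to 0, so it holds down to N = 0,
    where S_al = S_be = 0.  Hence the signed sum of the T_ga(0) vanishes.

    2. T_mu(0) is the sum of zeta^+(nu) over the refinements nu of mu.  This is
    a connected sum argument in the style of Seki and Yamamoto: the kernel
    n! b!/(n+b+1)! moves the entries of mu one unit at a time from the
    sequence D_mu n 0 to a growing chain of summation indices. *)

From HB Require Import structures.
From mathcomp Require Import all_boot all_order all_algebra finmap.
From mathcomp Require Import boolp classical_sets functions cardinality fsbigop.
From mathcomp Require Import reals ereal esum topology normedtype sequences.
From mathcomp Require Import freeg ring lra.
Require Import Defs.

Set Implicit Arguments.
Unset Strict Implicit.
Unset Printing Implicit Defensive.

Import Order.TTheory GRing.Theory Num.Theory.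
Import numFieldNormedType.Exports.

Local Open Scope classical_set_scope.
Local Open Scope ring_scope.

(** * Moment arrays and star sums *)

Section Moments.
Variable R : realType.
Implicit Types (D : nat -> nat -> R) (mu : seq nat).

(** When [D] holds the moments of a measure, this replaces s by s t and averages over t in [0, 1];
    integrating by parts in t gives the recursion. *)
Fixpoint raise D (n N : nat) : R :=
  (D n N + (if n is m.+1 then n%:R * raise D m N else 0)) / (n + N).+1%:R.

Definition flip D (n N : nat) := D N n.

Definition prepend D := flip (raise (flip D)).

(** The base array holds the moments of the unit mass at s = 0. *)
Fixpoint mom mu : nat -> nat -> R :=
  if mu is k :: mu' then iter k.-1 raise (prepend (mom mu'))
  else fun _ N => (N == 0)%:R.

(** Moments satisfy this because 1 = (1 - s) + s. *)
Definition pascal D := forall n N, D n N = D n.+1 N + D n N.+1.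

Definition nonneg D := forall n N, 0 <= D n N.

Lemma raiseE D n N :
  (n + N).+1%:R * raise D n N = D n N + n%:R * raise D n.-1 N.
Proof.
have nz k : k.+1%:R != 0 :> R by rewrite pnatr_eq0.
by case: n => [|n] /=; rewrite mulrC mulfVK // mul0r.
Qed.

Lemma prependE D n N :
  (n + N).+1%:R * prepend D n N = D n N + N%:R * prepend D n N.-1.
Proof. by rewrite addnC [LHS]raiseE. Qed.

Lemma pascal_flip D : pascal D -> pascal (flip D).
Proof. by move=> DP n N; rewrite /flip addrC -DP. Qed.

Lemma pascal_raise D : pascal D -> pascal (raise D).
Proof.
move=> DP n N; elim: n N => [|n IHn] N.
  have e1 : N.+1%:R * raise D 0 N = D 0 N.
    by have := raiseE D 0 N; rewrite mul0r addr0.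
  have e2 : N.+2%:R * raise D 0 N.+1 = D 0 N.+1.
    by have := raiseE D 0 N.+1; rewrite mul0r addr0.
  have e3 : N.+2%:R * raise D 1 N = D 1 N + raise D 0 N.
    by have := raiseE D 1 N; rewrite mul1r.
  have nz : N.+2%:R != 0 :> R by rewrite pnatr_eq0.
  by apply: (mulfI nz); rewrite mulrDr e2 e3 mulrSr mulrDl e1 DP mul1r addrAC.
have nz : (n.+1 + N).+2%:R != 0 :> R by rewrite pnatr_eq0.
apply: (mulfI nz); rewrite mulrDr.
have := raiseE D n.+2 N; rewrite addSn [n.+2.-1]/= => ->.
have := raiseE D n.+1 N.+1; rewrite addnS [n.+1.-1]/= => ->.
rewrite [in LHS]mulrSr mulrDl raiseE [n.+1.-1]/= DP (IHn N).
by rewrite [n.+2%:R]mulrSr; ring.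
Qed.

Lemma pascal_prepend D : pascal D -> pascal (prepend D).
Proof. by move=> DP; apply/pascal_flip/pascal_raise/pascal_flip. Qed.

Lemma pascal_mom mu : pascal (mom mu).
Proof.
elim: mu => [|k mu IHmu] /=; first by move=> n N; rewrite addr0.
elim: k.-1 => [|j IHj]; first exact: pascal_prepend.
exact: pascal_raise.
Qed.

Lemma nonneg_raise D : nonneg D -> nonneg (raise D).
Proof.
move=> D0 n N; elim: n => [|n IHn] /=; rewrite divr_ge0 ?ler0n// addr_ge0//.
by rewrite mulr_ge0.
Qed.

Lemma nonneg_mom mu : nonneg (mom mu).
Proof.
elim: mu => [|k mu IHmu] /=; first by move=> n N; rewrite ler0n.
elim: k.-1 => [|j IHj]; last exact: nonneg_raise.
by move=> n N; apply: nonneg_raise => {}n {}N; exact: IHmu.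
Qed.

Lemma mom_raise k mu : (0 < k)%N -> mom (k.+1 :: mu) = raise (mom (k :: mu)).
Proof. by case: k. Qed.

(** Substituting [pascal] for [raise D] into [raiseE] leaves a relation that can be divided by n + 1
    and summed over n, as [raise_logdiff] does. *)
Lemma raise_step D n N : pascal D ->
  N.+1%:R * raise D n.+1 N = D n.+1 N + n.+1%:R * raise D n N.+1.
Proof.
move=> DP; have := raiseE D n.+1 N; rewrite [n.+1.-1]/= (pascal_raise DP n N).
rewrite -addnS natrD mulrDl mulrDr addrCA => /addrI ->.
by [].
Qed.

Lemma prepend_step D n N : pascal D ->
  n.+1%:R * prepend D n N.+1 = D n N.+1 + N.+1%:R * prepend D n.+1 N.
Proof. by move=> DP; apply: raise_step; exact: pascal_flip. Qed.

(** * Star sums as partial sums of row 0 *)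

Definition star mu N : R := \sum_(j < N) mom mu 0 j.

Lemma starS mu N : star mu N.+1 = star mu N + mom mu 0 N.
Proof. by rewrite /star big_ord_recr. Qed.

Lemma star0 mu : star mu 0 = 0.
Proof. by rewrite /star big_ord0. Qed.

Lemma star_nil N : star [::] N.+1 = 1.
Proof.
by elim: N => [|N IHN]; rewrite starS ?star0 ?IHN /= ?add0r ?addr0.
Qed.

Lemma star_ge0 mu N : 0 <= star mu N.
Proof. by apply: sumr_ge0 => j _; exact: nonneg_mom. Qed.

(** In row 0, [prepend] averages the entries up to N, and each [raise] divides the entry at N by N +
    1. *)
Lemma mom_row0 k mu N : (0 < k)%N ->
  mom (k :: mu) 0 N = N.+1%:R^-1 ^+ k * star mu N.+1.
Proof.
have nz j : j.+1%:R != 0 :> R by rewrite pnatr_eq0.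
case: k => // k _; elim: k => [|k IHk].
  elim: N => [|N IHN].
    have := prependE (mom mu) 0 0; rewrite mul0r addr0 mul1r => e.
    by rewrite [LHS]e starS star0 add0r invr1 mul1r.
  apply: (mulfI (nz N.+1));
  rewrite [LHS](prependE (mom mu) 0 N.+1) [prepend _ _ _]IHN.
  by rewrite !expr1 !mulVKf // [in RHS]starS addrC.
rewrite mom_raise//; apply: (mulfI (nz N)).
by have := raiseE (mom (k.+1 :: mu)) 0 N; rewrite IHk mul0r addr0 => ->;
  rewrite [in RHS]exprS -[in RHS]mulrA mulVKf.
Qed.

(** Row 0 for [k :: mu] is bounded by the means of row 0 for [mu], so Cesaro's theorem carries the
    limit 0 through the induction. *)
Lemma mom_row0_cvg mu : all (leq 1) mu -> mom mu 0 @ \oo --> (0 : R).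
Proof.
elim: mu => [_|k mu IHmu /andP[k0 /IHmu {}IHmu]].
  by rewrite -cvg_shiftS /=; exact: cvg_cst.
apply: (squeeze_cvgr (f := cst 0) (h := arithmetic_mean (mom mu 0))).
- near=> N; rewrite (nonneg_mom (k :: mu)) [mom (k :: mu) _ _]mom_row0//=.
  rewrite /arithmetic_mean /= seriesEord ler_wpM2r ?star_ge0//.
  rewrite -(prednK k0) exprS ler_piMr ?invr_ge0//.
  by rewrite exprn_ile1 ?invr_ge0// invf_le1// ler1n.
- exact: cvg_cst.
- exact: cesaro.
Unshelve. all: by end_near. Qed.

Lemma star_mean_cvg mu : all (leq 1) mu ->
  (fun N => N.+1%:R^-1 * star mu N.+1) @ \oo --> (0 : R).
Proof.
move=> mu0; rewrite (_ : (fun N => _) = mom (1%N :: mu) 0).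
  exact: mom_row0_cvg.
by apply/funext => N; rewrite [RHS]mom_row0// expr1.
Qed.

End Moments.

(** * The derivative of the star sums *)

Section Derivative.
Variable R : realType.
Implicit Types (D : nat -> nat -> R) (mu : seq nat).

(** For moments, the integral of s^N (-log s) / (1 - s), possibly infinite. *)
Definition logsum D N : \bar R := \sum_(n <oo) (D n N / n.+1%:R)%:E.

(** For moments, the integral of s^N (-log s), which is minus the derivative of [D 0 N] in N. *)
Definition logdiff D N : \bar R := \sum_(n <oo) (D n.+1 N / n.+1%:R)%:E.

Lemma logsum_ge0 D N : nonneg D -> (0 <= logsum D N)%E.
Proof.
by move=> D0; apply: nneseries_ge0 => n _ _; rewrite lee_fin divr_ge0.
Qed.

Lemma logdiff_ge0 D N : nonneg D -> (0 <= logdiff D N)%E.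
Proof.
by move=> D0; apply: nneseries_ge0 => n _ _; rewrite lee_fin divr_ge0.
Qed.

Lemma logsumS D N : pascal D -> nonneg D ->
  logsum D N = (logsum D N.+1 + logdiff D N)%E.
Proof.
move=> DP D0; rewrite -nneseriesD; last 2 first.
- by move=> n _ _; rewrite lee_fin divr_ge0.
- by move=> n _ _; rewrite lee_fin divr_ge0.
by apply: eq_eseriesr => n _; rewrite -EFinD -mulrDl addrC -DP.
Qed.

Lemma nneseries_lty_cvg (u : nat -> R) : (forall n, 0 <= u n) ->
  (\sum_(n <oo) (u n)%:E < +oo)%E -> cvgn (series u).
Proof.
move=> u0 uoo; apply: nondecreasing_is_cvgn.
  by apply/nondecreasing_seqP => n; rewrite seriesSr lerDl.
exists (fine (\sum_(n <oo) (u n)%:E)) => _ [n _ <-].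
rewrite -lee_fin fineK; last first.
  by rewrite ge0_fin_numE//; apply: nneseries_ge0 => k _ _; rewrite lee_fin.
rewrite /series -sumEFin; apply: nneseries_lim_ge => k _ _.
by rewrite lee_fin.
Qed.

Lemma nneseries_le (u : nat -> R) (C : R) : (forall n, 0 <= u n) ->
  (forall n, \sum_(k < n) u k <= C) -> (\sum_(n <oo) (u n)%:E <= C%:E)%E.
Proof.
move=> u0 uC; apply: lime_le.
  by apply: is_cvg_nneseries => n _ _; rewrite lee_fin.
by near=> n; rewrite sumEFin lee_fin big_mkord.
Unshelve. all: by end_near. Qed.

Lemma nneseries_cvg (u : nat -> R) (l : R) :
  series u @ \oo --> l -> (\sum_(n <oo) (u n)%:E = l%:E)%E.
Proof.
move=> ul; apply: cvg_lim => //.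
rewrite (_ : (fun n => _) = EFin \o series u).
  by apply: cvg_EFin; [exact: nearW|exact: ul].
by apply/funext => n /=; rewrite /series /= sumEFin.
Qed.

(* As D is nonincreasing in its first argument, convergence of the harmonically
   weighted sum [logsum] forces D n N --> 0. *)
Lemma col_cvg0 D N : pascal D -> nonneg D -> (logsum D N < +oo)%E ->
  D ^~ N @ \oo --> (0 : R).
Proof.
move=> DP D0 Doo.
have Dmono : nonincreasing_seq (D ^~ N).
  by apply/nonincreasing_seqP => n; rewrite (DP n N) lerDl.
have Dlb : has_lbound (range (D ^~ N)) by exists 0 => _ [n _ <-].
have Dcv : cvgn (D ^~ N) by exact: nonincreasing_is_cvgn.
have [L0|Lpos] := leP (limn (D ^~ N)) 0.
  suff L : limn (D ^~ N) = 0 by rewrite -L.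
  by apply/eqP; rewrite eq_le L0/=; apply: limr_ge => //; near=> n.
exfalso; apply: (@dvg_harmonic R).
have Dle n : limn (D ^~ N) <= D n N by exact: nonincreasing_cvgn_ge.
have h : cvgn (series (limn (D ^~ N) \*: @sequences.harmonic R)).
  apply: (@series_le_cvg _ _ (fun n => D n N / n.+1%:R)).
  - by move=> n /=; rewrite mulr_ge0 ?(ltW Lpos)// harmonic_ge0.
  - by move=> n /=; rewrite divr_ge0.
  - by move=> n /=; rewrite ler_wpM2r// invr_ge0.
  - by apply: nneseries_lty_cvg => // n; rewrite divr_ge0.
have -> : series (@sequences.harmonic R) =
    (limn (D ^~ N))^-1 \*: series (limn (D ^~ N) \*: @sequences.harmonic R).
  apply/funext => n /=; rewrite /series /= -mulr_sumr.
  by rewrite [RHS]mulKf// gt_eqF.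
exact: is_cvgZr.
Unshelve. all: by end_near. Qed.

(** By [pascal] the terms are D n N - D n.+1 N, and the sum telescopes. For N = 0 the limit
    [col_cvg0] says that the measure has no mass at s = 0. *)
Lemma col_sum D N : pascal D -> nonneg D -> (logsum D N < +oo)%E ->
  (\sum_(n <oo) (D n N.+1)%:E = (D 0 N)%:E)%E.
Proof.
move=> DP D0 Doo; apply: nneseries_cvg.
have -> : series (fun n => D n N.+1) = fun n => D 0 N - D n N.
  apply/funext; elim=> [|n IHn]; first by rewrite /series/= big_geq// subrr.
  by rewrite seriesSr IHn (DP n N); ring.
rewrite -[X in _ --> X]subr0; apply: cvgB; first exact: cvg_cst.
exact: col_cvg0.
Qed.

(** * Finiteness of [logsum] for nonempty words *)

Definition logbounded D :=
  exists C : R, forall K, \sum_(n < K) D n 0 / n.+1%:R <= C.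

(** [logsum D N] is nonincreasing in N, so a bound at N = 0 suffices. *)
Lemma logbounded_lty D N : pascal D -> nonneg D -> logbounded D ->
  (logsum D N < +oo)%E.
Proof.
move=> DP D0 [C DC]; apply: (@le_lt_trans _ _ (logsum D 0)).
  elim: N => // N; apply: le_trans; rewrite (logsumS N DP D0).
  by rewrite leeDl// logdiff_ge0.
apply: (le_lt_trans (nneseries_le _ DC)); last exact: ltry.
by move=> n; rewrite divr_ge0.
Qed.

Lemma raise_col0 D n :
  raise D n 0 = n.+1%:R^-1 * \sum_(m < n.+1) D m 0.
Proof.
elim: n => [|n IHn]; first by rewrite big_ord1 /= addr0 mulrC.
rewrite /= addn0 mulrC IHn mulVKf ?pnatr_eq0//.
by rewrite [in RHS]big_ord_recr /= addrC.
Qed.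

Lemma prepend_col0 D n : prepend D n 0 = n.+1%:R^-1 * D n 0.
Proof. by rewrite /prepend /flip /= addr0 mulrC. Qed.

Lemma inv_sqr_le K : K.+1%:R^-1 ^+ 2 + 2 * K.+2%:R^-1 <= 2 * K.+1%:R^-1 :> R.
Proof.
rewrite -subr_ge0 (_ : _ - _ = K%:R / (K.+1%:R ^+ 2 * K.+2%:R)).
  by rewrite divr_ge0 ?mulr_ge0 ?exprn_ge0.
rewrite -[K.+2]addn2 -[K.+1]addn1 !natrD; have := ler0n R K.
by move: (K%:R) => x x0; field; apply/andP; split; apply: lt0r_neq0;
  rewrite ltr_wpDl.
Qed.

(* Abel summation, using [inv_sqr_le]. *)
Lemma logbounded_raise D : nonneg D -> logbounded D -> logbounded (raise D).
Proof.
move=> D0 [C DC]; pose A k := \sum_(m < k) D m 0.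
have A0 k : 0 <= A k by apply: sumr_ge0 => m _; exact: D0.
have AS k : A k.+1 = A k + D k 0%N by rewrite /A big_ord_recr.
exists (2 * C) => K; apply: (@le_trans _ _
    (\sum_(n < K) raise D n 0 / n.+1%:R + 2 * A K / K.+1%:R)).
  by rewrite lerDl divr_ge0 ?mulr_ge0.
apply: (@le_trans _ _ (2 * \sum_(n < K) D n 0 / n.+1%:R)); last first.
  by rewrite ler_pM2l.
elim: K => [|K IHK]; first by rewrite !big_ord0 /A big_ord0 !mulr0 mul0r addr0.
rewrite !big_ord_recr /= raise_col0 -/(A _) mulrDr.
have := ler_wpM2l (A0 K.+1) (inv_sqr_le K); rewrite AS; move: IHK.
by move: (K.+1%:R^-1) (K.+2%:R^-1) (\sum_(n < K) _) (\sum_(n < K) _) (A K)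
  (D K 0%N) => x y s t a d; lra.
Qed.

(** The empty word gives the harmonic series. One [prepend] turns it into the sum of 1/(n+1)^2; on a
    nonempty word [prepend] only decreases column 0. *)
Lemma logbounded_mom mu : mu != [::] -> logbounded (mom R mu).
Proof.
elim: mu => // k mu IHmu _.
suff h1 : logbounded (prepend (mom R mu)).
  rewrite /=; elim: k.-1 => // j IHj; apply: logbounded_raise => //.
  by have := nonneg_mom R (j.+1 :: mu).
case: mu IHmu => [|l mu] IHmu.
  (* By [inv_sqr_le], adding 2/(K+1) to the partial sum gives a quantity that is nonincreasing in K
     and equals 2 at K = 0. *)
  exists 2 => K; apply: (@le_trans _ _
      (\sum_(n < K) prepend (mom R [::]) n 0 / n.+1%:R + 2 * K.+1%:R^-1)).
    by rewrite lerDl mulr_ge0.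
  elim: K => [|K IHK]; first by rewrite big_ord0 add0r invr1 mulr1.
  rewrite big_ord_recr /= prepend_col0 /= mulr1.
  have := inv_sqr_le K; move: IHK.
  by move: (K.+1%:R^-1) (K.+2%:R^-1) (\sum_(n < K) _) => x y s; lra.
have [//|C muC] := IHmu; exists C => K; apply: le_trans (muC K).
apply: ler_sum => n _; rewrite prepend_col0 ler_wpM2r ?invr_ge0//.
by rewrite ler_piMl ?nonneg_mom// invf_le1// ler1n.
Qed.

Lemma logsum_mom_lty mu N : mu != [::] -> (logsum (mom R mu) N < +oo)%E.
Proof.
move=> mu0; apply: logbounded_lty; last exact: logbounded_mom.
  exact: pascal_mom.
exact: nonneg_mom.
Qed.

Lemma logsum_mom_nil N : logsum (mom R [::]) N.+1 = 0%E.
Proof. by rewrite /logsum eseries0// => n _ _; rewrite mul0r. Qed.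

(** The shift to N + 1 admits the empty word, whose mass at s = 0 no longer contributes. *)
Lemma logsumS_mom_fin mu N : logsum (mom R mu) N.+1 \is a fin_num.
Proof.
rewrite ge0_fin_numE ?logsum_ge0//; last exact: nonneg_mom.
by case: mu => [|k mu]; rewrite ?logsum_mom_nil// logsum_mom_lty.
Qed.

(** The sum diverges only for the empty word at N = 0, where [fine] returns 0. *)
Definition dstar mu N : R := fine (logsum (mom R mu) N).

Lemma dstar_ge0 mu N : 0 <= dstar mu N.
Proof. by apply/fine_ge0/logsum_ge0/nonneg_mom. Qed.

Lemma dstar_nil N : dstar [::] N.+1 = 0.
Proof. by rewrite /dstar logsum_mom_nil. Qed.

(** The derivative of (z + 1) P(z) = S(z + 1) at z = N, with P row 0 of [prepend D] and S the
    partial sums of row 0 of [D]. The proof sums [prepend_step] divided by n + 1, and [col_sum]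
    expands P(N). *)
Lemma prepend_logdiff D N : pascal D -> nonneg D ->
  (logsum (prepend D) N < +oo)%E ->
  ((prepend D 0 N)%:E = N.+1%:R%:E * logdiff (prepend D) N + logsum D N.+1)%E.
Proof.
move=> DP D0 Doo; have P0 : nonneg (prepend D).
  by move=> n m; apply: nonneg_raise => {}n {}m; exact: D0.
rewrite -col_sum//; last exact: pascal_prepend.
rewrite -nneseriesZl; last by move=> n _; rewrite lee_fin divr_ge0 ?P0 ?D0.
rewrite -nneseriesD; last 2 first.
- by move=> n _ _; rewrite -EFinM lee_fin mulr_ge0// divr_ge0 ?P0.
- by move=> n _ _; rewrite lee_fin divr_ge0 ?P0 ?D0.
apply: eq_eseriesr => n _; rewrite -EFinM -EFinD; congr EFin.
have nz : n.+1%:R != 0 :> R by rewrite pnatr_eq0.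
rewrite -[LHS](mulKf nz) prepend_step// mulrDr addrC mulrCA.
by congr (_ * _ + _); rewrite mulrC.
Qed.

(** Likewise the derivative of (z + 1) E(z) = D(z), relating row 0 of [raise D] to row 0 of [D]. *)
Lemma raise_logdiff D N : pascal D -> nonneg D ->
  (logsum (raise D) N < +oo)%E ->
  (N.+1%:R%:E * logdiff (raise D) N = logdiff D N + (raise D 0 N)%:E)%E.
Proof.
move=> DP D0 Doo; have P0 : nonneg (raise D) by exact: nonneg_raise.
rewrite -col_sum//; last exact: pascal_raise.
rewrite -nneseriesZl; last by move=> n _; rewrite lee_fin divr_ge0 ?P0 ?D0.
rewrite -nneseriesD; last 2 first.
- by move=> n _ _; rewrite lee_fin divr_ge0 ?P0 ?D0.
- by move=> n _ _; rewrite lee_fin P0.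
apply: eq_eseriesr => n _; rewrite -EFinM -EFinD; congr EFin.
have nz : n.+1%:R != 0 :> R by rewrite pnatr_eq0.
by rewrite mulrA raise_step// mulrDl mulrAC mulfV// mul1r.
Qed.

Lemma dstarK mu N : (dstar mu N.+1)%:E = logsum (mom R mu) N.+1.
Proof. exact/fineK/logsumS_mom_fin. Qed.

Lemma logdiff_mom_fin mu N : mu != [::] -> logdiff (mom R mu) N \is a fin_num.
Proof.
move=> mu0; rewrite ge0_fin_numE ?logdiff_ge0//; last exact: nonneg_mom.
apply: le_lt_trans (logsum_mom_lty N mu0).
rewrite (logsumS N (pascal_mom R mu) (@nonneg_mom R mu)) leeDr// logsum_ge0//.
exact: nonneg_mom.
Qed.

(* The value is minus the derivative of star mu z / z ^ k at z = N + 1. *)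
Lemma logdiff_mom k mu N : (0 < k)%N ->
  logdiff (mom R (k :: mu)) N =
  (k%:R * N.+1%:R^-1 ^+ k.+1 * star R mu N.+1
   - N.+1%:R^-1 ^+ k * dstar mu N.+1)%:E.
Proof.
have nz : N.+1%:R != 0 :> R by rewrite pnatr_eq0.
case: k => // k _; elim: k => [|k IHk].
  have := @prepend_logdiff _ N (pascal_mom R mu) (@nonneg_mom R mu)
    (@logsum_mom_lty [:: 1%N & mu] N isT).
  rewrite -[prepend _ 0 N]/(mom R (1%N :: mu) 0 N) mom_row0// -dstarK.
  have := @logdiff_mom_fin [:: 1%N & mu] N isT.
  rewrite -[prepend _]/(mom R (1%N :: mu)) => /fineK <-.
  rewrite -EFinM -EFinD => -[e]; congr EFin; apply: (mulfI nz).
  rewrite mulrBr -[LHS](addrK (dstar mu N.+1)) -e !expr1 exprS expr1 mul1r.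
  by rewrite -mulrA !mulVKf.
have := @raise_logdiff _ N (pascal_mom R (k.+1 :: mu))
  (@nonneg_mom R (k.+1 :: mu)) (@logsum_mom_lty [:: k.+2 & mu] N isT).
rewrite IHk -[raise _ 0 N]/(mom R (k.+2 :: mu) 0 N) mom_row0//.
have := @logdiff_mom_fin [:: k.+2 & mu] N isT.
rewrite -[raise _]/(mom R (k.+2 :: mu)) => /fineK <-.
rewrite -EFinM -EFinD => -[e]; congr EFin; apply: (mulfI nz); rewrite e.
rewrite mulrBr [_ ^+ k.+3]exprS [in RHS](exprS _ k.+1) -!mulrA.
rewrite [N.+1%:R * (k.+2%:R * _)]mulrCA.
by rewrite !mulVKf// [k.+2%:R]mulrSr; ring.
Qed.

(** The derivative of the difference equation [starS], with row 0 written as in [mom_row0]. *)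
Lemma dstarS k mu N : (0 < k)%N -> dstar (k :: mu) N = dstar (k :: mu) N.+1 +
  (k%:R * N.+1%:R^-1 ^+ k.+1 * star R mu N.+1
   - N.+1%:R^-1 ^+ k * dstar mu N.+1).
Proof.
move=> k0; rewrite /dstar.
rewrite (logsumS N (pascal_mom R (k :: mu)) (@nonneg_mom R (k :: mu))).
by rewrite -dstarK logdiff_mom.
Qed.

(** Nonnegativity of [logdiff] for [1 :: mu]: the quotient star mu z / z does not increase in z. *)
Lemma dstar_le mu N : dstar mu N.+1 <= N.+1%:R^-1 * star R mu N.+1.
Proof.
have := @logdiff_mom 1 mu N isT.
have := logdiff_ge0 N (@nonneg_mom R [:: 1%N & mu]) => /[swap] ->.
by rewrite lee_fin subr_ge0 !expr1 mul1r exprS expr1 -mulrA ler_pM2l.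
Qed.

End Derivative.

(** * The harmonic product *)

(** The first column is (a, 0), (0, b) or (a, b). The inner [fix] keeps [al] and consumes [be], so
    that both recursions are structural. *)
Fixpoint matrices (al : seq nat) : seq nat -> seq (seq (nat * nat)) :=
  if al is a :: al' then
    fix inner be := if be is b :: be' then
      [seq (a, 0%N) :: M | M <- matrices al' be]
      ++ [seq (0%N, b) :: M | M <- inner be']
      ++ [seq (a, b) :: M | M <- matrices al' be']
    else [:: [seq (i, 0%N) | i <- al]]
  else fun be => [:: [seq (0%N, j) | j <- be]].

(** [in_H] on plain sequences: the recursion reaches empty tails, which are not multi-indices. *)
Definition is_matrix (al be : seq nat) (M : seq (nat * nat)) : bool :=
  [&& [seq m <- [seq c.1 | c <- M] | m != 0%N] == al,
      [seq m <- [seq c.2 | c <- M] | m != 0%N] == be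
    & all (fun c => 0 < c.1 + c.2)%N M].

Lemma matrices_nilr al : matrices al [::] = [:: [seq (i, 0%N) | i <- al]].
Proof. by case: al. Qed.

Lemma matrices_cons a al b be : matrices (a :: al) (b :: be) =
  [seq (a, 0%N) :: M | M <- matrices al (b :: be)]
  ++ [seq (0%N, b) :: M | M <- matrices (a :: al) be]
  ++ [seq (a, b) :: M | M <- matrices al be].
Proof. by []. Qed.

Lemma mem_map_cons (T : eqType) (x y : T) s l :
  (x :: s \in [seq y :: t | t <- l]) = (x == y) && (s \in l).
Proof.
apply/mapP/andP => [[t tl [-> ->]]|[/eqP -> sl]]; first by rewrite eqxx.
by exists s.
Qed.

Lemma nil_map_cons (T : eqType) (y : T) l :
  [::] \in [seq y :: t | t <- l] = false.
Proof. by apply/mapP => -[]. Qed.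

Ltac case_eqs :=
  rewrite /= ?eqxx; repeat match goal with
    | |- context [?n.+1 == 0%N] => change (n.+1 == 0%N) with false
    | |- context [0%N == ?n.+1] => change (0%N == n.+1) with false
    end; repeat match goal with |- context [?x == ?y] => case: (x == y) end;
  rewrite ?andbF ?orbF.

Lemma mem_matrices al be M : all (leq 1) al -> all (leq 1) be ->
  (M \in matrices al be) = is_matrix al be M.
Proof.
move=> + be0; elim: al M be be0 => [|a al IHal] M be be0 => [_|/andP[a0 al0]].
  rewrite mem_seq1 /is_matrix; elim: be M be0 => [|b be IHbe] M.
    by move=> _; case: M => [|[[|i] [|j]] M] //=; rewrite ?andbF.
  move=> /andP[b0 be0]; case: M => // -[[|i] j] M; last by [].
  rewrite /= eqseq_cons xpair_eqE IHbe //= add0n.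
  by case: j => [|j]; [case: b b0 => // b _|rewrite eqseq_cons]; case_eqs.
elim: be be0 M => [_|b be IHbe /andP[b0 be0]] M.
  rewrite matrices_nilr mem_seq1.
  have {IHal} := IHal _ [::] isT al0; rewrite matrices_nilr => IHal.
  case: M => // -[i j] M; rewrite /= eqseq_cons xpair_eqE.
  have := IHal M; rewrite mem_seq1 => ->; rewrite /is_matrix /=.
  case: i => [|i]; [case: a a0 {IHal} => // a _|rewrite eqseq_cons];
    by case: j => [|j]; case_eqs.
rewrite matrices_cons !mem_cat; case: M => [|[i j] M].
  by rewrite !nil_map_cons.
rewrite !mem_map_cons !xpair_eqE !IHal//= ?b0// IHbe// /is_matrix /=.
case: a a0 {IHbe} => // a _; case: b b0 => // b _.
by case: i => [|i]; case: j => [|j] /=; rewrite ?eqseq_cons; case_eqs.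
Qed.

Lemma uniq_matrices al be : all (leq 1) al -> all (leq 1) be ->
  uniq (matrices al be).
Proof.
move=> + be0; elim: al be be0 => [|a al IHal] be be0 => [//|/andP[a0 al0]].
elim: be be0 => [//|b be IHbe /andP[b0 be0]].
rewrite matrices_cons !cat_uniq !map_inj_uniq; try by move=> ? ? [].
have bbe0 : all (leq 1) (b :: be) by rewrite /= b0.
rewrite !IHal // IHbe // andbT /=.
apply/andP; split; apply/hasPn => -[|[i j] M].
- by rewrite mem_cat !nil_map_cons.
- rewrite mem_cat !mem_map_cons !xpair_eqE.
  case: a a0 {IHbe} => // a _; case: b b0 {be0 bbe0} => // b _.
  by case: i => [|i]; case: j => [|j] /=; rewrite ?andbF.
- by rewrite nil_map_cons.
- rewrite !mem_map_cons !xpair_eqE; case: a a0 {IHbe} => // a _.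
  by case: i => [|i]; rewrite ?andbF.
Qed.

Lemma column_sums_nill be : column_sums [seq (0%N, j) | j <- be] = be.
Proof. by elim: be => //= b be ->. Qed.

Lemma column_sums_nilr al : column_sums [seq (i, 0%N) | i <- al] = al.
Proof. by elim: al => //= a al ->; rewrite addn0. Qed.

Section QuasiShuffle.
Variable R : realType.
Implicit Types (al be mu : seq nat) (N : nat).

(** The sign gives all terms of [sstarS] coefficient +1, so that a merged column (a, b) enters the
    product with a plus sign. *)
Definition sstar mu N : R := (-1) ^+ size mu * star R mu N.
Definition sdstar mu N : R := (-1) ^+ size mu * dstar R mu N.

Definition qsum (F : seq nat -> nat -> R) al be N : R :=
  \sum_(M <- matrices al be) F (column_sums M) N.

Lemma qsum_nill F be N : qsum F [::] be N = F be N.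
Proof. by rewrite /qsum big_seq1 column_sums_nill. Qed.

Lemma qsum_nilr F al N : qsum F al [::] N = F al N.
Proof. by rewrite /qsum matrices_nilr big_seq1 column_sums_nilr. Qed.

Lemma qsum_cons F a al b be N : qsum F (a :: al) (b :: be) N =
  qsum (fun mu => F (a :: mu)) al (b :: be) N
  + qsum (fun mu => F (b :: mu)) (a :: al) be N
  + qsum (fun mu => F ((a + b)%N :: mu)) al be N.
Proof.
rewrite /qsum matrices_cons !big_cat !big_map /= addrA.
by congr (_ + _ + _); apply: eq_bigr => M _; rewrite /= ?addn0.
Qed.

Lemma sstarS k mu N : (0 < k)%N -> sstar (k :: mu) N =
  sstar (k :: mu) N.+1 + N.+1%:R^-1 ^+ k * sstar mu N.+1.
Proof. by move=> k0; rewrite /sstar starS mom_row0//= exprS; ring. Qed.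

Lemma sdstarS k mu N : (0 < k)%N -> sdstar (k :: mu) N =
  sdstar (k :: mu) N.+1 + N.+1%:R^-1 ^+ k * sdstar mu N.+1
  - k%:R * N.+1%:R^-1 ^+ k.+1 * sstar mu N.+1.
Proof. by move=> k0; rewrite /sdstar /sstar dstarS//= exprS; ring. Qed.

Lemma sstar0 mu : sstar mu 0 = 0.
Proof. by rewrite /sstar star0 mulr0. Qed.

Lemma sstar_nil N : sstar [::] N.+1 = 1.
Proof. by rewrite /sstar star_nil mul1r. Qed.

Lemma sdstar_nil N : sdstar [::] N.+1 = 0.
Proof. by rewrite /sdstar dstar_nil mulr0. Qed.

Lemma qsum_addZ (F : seq nat -> nat -> R) (k : nat) (x : R) al be N
    (F1 F2 : seq nat -> nat -> R) :
  (forall mu, F (k :: mu) N = F1 (k :: mu) N.+1 + x * F2 mu N.+1) ->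
  qsum (fun mu => F (k :: mu)) al be N =
  qsum (fun mu => F1 (k :: mu)) al be N.+1 + x * qsum F2 al be N.+1.
Proof.
by move=> FE; rewrite /qsum mulr_sumr -big_split; apply: eq_bigr => M _.
Qed.

(** For nonempty words both sides vanish at 0. Expanding (A + x^a A')(B + x^b B') by [sstarS] gives
    the four terms that [qsum_cons] produces, and the shorter words are known by induction. *)
Lemma qsum_sstar al be N : all (leq 1) al -> all (leq 1) be ->
  qsum sstar al be N.+1 = sstar al N.+1 * sstar be N.+1.
Proof.
elim: al be N => [|a al IHal] be N; first by rewrite qsum_nill sstar_nil mul1r.
move=> /andP[a0 al0].
elim: be N => [|b be IHbe] N; first by rewrite qsum_nilr sstar_nil mulr1.
move=> /andP[b0 be0].
suff h : forall m, qsum sstar (a :: al) (b :: be) m =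
  sstar (a :: al) m * sstar (b :: be) m by exact: h.
have bbe0 : all (leq 1) (b :: be) by rewrite /= b0.
have S m : qsum sstar (a :: al) (b :: be) m =
  qsum sstar (a :: al) (b :: be) m.+1
  + m.+1%:R^-1 ^+ a * qsum sstar al (b :: be) m.+1
  + m.+1%:R^-1 ^+ b * qsum sstar (a :: al) be m.+1
  + m.+1%:R^-1 ^+ (a + b) * qsum sstar al be m.+1.
  rewrite !qsum_cons.
  rewrite (qsum_addZ _ _ (fun mu => sstarS mu m a0)).
  rewrite (qsum_addZ _ _ (fun mu => sstarS mu m b0)).
  have ab0 : (0 < a + b)%N by rewrite addn_gt0 a0.
  by rewrite (qsum_addZ _ _ (fun mu => sstarS mu m ab0)); ring.
elim=> [|m IHm].
  rewrite sstar0 mul0r /qsum big1_seq// => M /andP[_ _]; exact: sstar0.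
have := S m; rewrite IHm {}IHbe// !IHal// (sstarS al m a0) (sstarS be m b0).
rewrite exprD => e.
apply/esym/(addIr (m.+1%:R^-1 ^+ a * (sstar al m.+1 * sstar (b :: be) m.+1)
  + m.+1%:R^-1 ^+ b * (sstar (a :: al) m.+1 * sstar be m.+1)
  + m.+1%:R^-1 ^+ a * m.+1%:R^-1 ^+ b * (sstar al m.+1 * sstar be m.+1))).
by rewrite [RHS]addrA [X in _ = X + _]addrA -e; ring.
Qed.

Lemma qsum_lin (F G : seq nat -> nat -> R) (x y : R) al be N :
  qsum (fun mu n => x * F mu n - y * G mu n) al be N =
  x * qsum F al be N - y * qsum G al be N.
Proof. by rewrite /qsum sumrB !mulr_sumr. Qed.

Lemma qsum_sdstarS a al b be N : (0 < a)%N -> (0 < b)%N ->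
  let x := N.+1%:R^-1 in
  qsum sdstar (a :: al) (b :: be) N =
  qsum sdstar (a :: al) (b :: be) N.+1
  + (x ^+ a * qsum sdstar al (b :: be) N.+1
     - a%:R * x ^+ a.+1 * qsum sstar al (b :: be) N.+1)
  + (x ^+ b * qsum sdstar (a :: al) be N.+1
     - b%:R * x ^+ b.+1 * qsum sstar (a :: al) be N.+1)
  + (x ^+ (a + b) * qsum sdstar al be N.+1
     - (a + b)%:R * x ^+ (a + b).+1 * qsum sstar al be N.+1).
Proof.
move=> a0 b0 x.
pose G k (nu : seq nat) n :=
  x ^+ k * sdstar nu n - k%:R * x ^+ k.+1 * sstar nu n.
(* The factor 1 matches the shape expected by [qsum_addZ]. *)
have S k mu : (0 < k)%N ->
    sdstar (k :: mu) N = sdstar (k :: mu) N.+1 + 1 * G k mu N.+1.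
  by move=> k0; rewrite sdstarS// mul1r /G -addrA.
have ab0 : (0 < a + b)%N by rewrite addn_gt0 a0.
have L k al' be' : (0 < k)%N -> qsum (fun mu => sdstar (k :: mu)) al' be' N =
    qsum (fun mu => sdstar (k :: mu)) al' be' N.+1
    + (x ^+ k * qsum sdstar al' be' N.+1
       - k%:R * x ^+ k.+1 * qsum sstar al' be' N.+1).
  move=> k0; rewrite (@qsum_addZ _ k 1 _ _ _ sdstar (G k)); last first.
    by move=> mu; exact: S.
  by rewrite mul1r -qsum_lin.
rewrite !qsum_cons !L//.
by rewrite [X in X + _ = _]addrACA [LHS]addrACA !addrA.
Qed.

Lemma matrices_pos al be M : all (leq 1) al -> all (leq 1) be ->
  M \in matrices al be -> all (leq 1) (column_sums M).
Proof.
by move=> al0 be0; rewrite mem_matrices// => /and3P[_ _]; rewrite all_map.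
Qed.

Lemma qsum_mean_cvg al be : all (leq 1) al -> all (leq 1) be ->
  (fun N => qsum (fun mu n => n%:R^-1 * star R mu n) al be N.+1) @ \oo
    --> (0 : R).
Proof.
move=> al0 be0; rewrite /qsum.
have : {in matrices al be, forall M, all (leq 1) (column_sums M)}.
  by move=> M; exact: matrices_pos.
elim: (matrices al be) => [_|M s IHs sP].
  by under eq_fun do rewrite big_nil; exact: cvg_cst.
have h1 : (fun N => N.+1%:R^-1 * star R (column_sums M) N.+1) @ \oo
    --> (0 : R).
  by apply: star_mean_cvg; apply: sP; rewrite mem_head.
have h2 := IHs (sub_in1 (@mem_behead _ (M :: s)) sP).
have := cvgD h1 h2; rewrite addr0 => h.
by under eq_fun do rewrite big_cons; exact: h.
Qed.

Lemma normr_sstar mu N : `|sstar mu N| = star R mu N.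
Proof. by rewrite /sstar normrM normr_sign mul1r ger0_norm ?star_ge0. Qed.

Lemma normr_sdstar_le mu N :
  `|sdstar mu N.+1| <= N.+1%:R^-1 * star R mu N.+1.
Proof.
by rewrite /sdstar normrM normr_sign mul1r ger0_norm ?dstar_ge0 ?dstar_le.
Qed.

Definition defect al be N := qsum sdstar al be N
  - (sstar al N * sdstar be N + sdstar al N * sstar be N).

(** By [dstar_le] each [sdstar] costs a factor 1/(N+1). In the two products, [qsum_sstar] then
    trades the product of star sums for a sum over the harmonic product. *)
Lemma defect_le al be N : all (leq 1) al -> all (leq 1) be ->
  `|defect al be N.+1| <=
  3 * qsum (fun mu n => n%:R^-1 * star R mu n) al be N.+1.
Proof.
move=> al0 be0; set y := qsum _ _ _ _.
have ly : N.+1%:R^-1 * (star R al N.+1 * star R be N.+1) <= y.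
  rewrite -!normr_sstar -normrM -qsum_sstar// /y /qsum -mulr_sumr.
  rewrite ler_pM2l ?invr_gt0// (le_trans (ler_norm_sum _ _ _))//.
  by under eq_bigr do rewrite normr_sstar.
have lt : `|qsum sdstar al be N.+1| <= y.
  rewrite (le_trans (ler_norm_sum _ _ _))//; apply: ler_sum => M _.
  exact: normr_sdstar_le.
have l1 : `|sstar al N.+1 * sdstar be N.+1| <= y.
  apply: le_trans ly; rewrite normrM normr_sstar mulrCA.
  by rewrite ler_wpM2l ?star_ge0 ?normr_sdstar_le.
have l2 : `|sdstar al N.+1 * sstar be N.+1| <= y.
  apply: le_trans ly; rewrite normrM normr_sstar mulrA.
  by rewrite ler_wpM2r ?star_ge0 ?normr_sdstar_le.
rewrite (le_trans (ler_normB _ _))//.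
have := ler_normD (sstar al N.+1 * sdstar be N.+1)
  (sdstar al N.+1 * sstar be N.+1).
move: lt l1 l2; lra.
Qed.

Lemma defect_eq0 al be N : all (leq 1) al -> all (leq 1) be ->
  defect al be N.+1 = 0.
Proof.
elim: al be N => [|a al IHal] be N.
  by rewrite /defect qsum_nill sstar_nil sdstar_nil mul1r mul0r addr0 subrr.
move=> /andP[a0 al0]; elim: be N => [|b be IHbe] N.
  by rewrite /defect qsum_nilr sstar_nil sdstar_nil mulr1 mulr0 add0r subrr.
move=> /andP[b0 be0]; have bbe0 : all (leq 1) (b :: be) by rewrite /= b0.
have aal0 : all (leq 1) (a :: al) by rewrite /= a0.
suff h : forall m, defect (a :: al) (b :: be) m = 0 by exact: h.
(* The three shorter defects vanish by induction; what remains is the product rule applied to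
   [sstarS]. *)
have hS m : defect (a :: al) (b :: be) m = defect (a :: al) (b :: be) m.+1.
  have := IHal (b :: be) m al0 bbe0; have := IHal be m al0 be0.
  have := IHbe m be0; rewrite /defect => /eqP + /eqP + /eqP.
  rewrite !subr_eq0 => /eqP e1 /eqP e2 /eqP e3.
  rewrite qsum_sdstarS// e1 e2 e3 !qsum_sstar// (sstarS al m a0).
  rewrite (sstarS be m b0) (sdstarS al m a0) (sdstarS be m b0).
  by rewrite !exprS exprD natrD; ring.
have hc m : defect (a :: al) (b :: be) m = defect (a :: al) (b :: be) 0.
  by elim: m => // m; rewrite hS.
have /cvgMl_tmp : (fun n => qsum (fun mu n => n%:R^-1 * star R mu n)
  (a :: al) (b :: be) n.+1) @ \oo --> (0 : R) by exact: qsum_mean_cvg.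
move=> /(_ 3); rewrite mulr0 => ycvg m; apply/normr0_eq0/eqP.
rewrite eq_le normr_ge0 andbT -(cvg_lim _ ycvg)//.
apply: limr_ge; first by apply/cvg_ex; exists 0.
(* The defect at m equals the one at 0, hence the one at n + 1, where the bound applies. *)
by near=> n; rewrite hc -(hc n.+1); exact: defect_le.
Unshelve. all: by end_near. Qed.

(** One step of [qsum_sdstarS] from 1 down to 0, with x = 1. Since [sstar] vanishes at 0,
    [sstar (a :: al) 1] is minus [sstar al 1], and everything cancels. *)
Lemma qsum_sdstar0 al be : all (leq 1) al -> all (leq 1) be ->
  al != [::] -> be != [::] -> qsum sdstar al be 0 = 0.
Proof.
case: al be => [|a al] [|b be] // /andP[a0 al0] /andP[b0 be0] _ _.
have bbe0 : all (leq 1) (b :: be) by rewrite /= b0.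
have aal0 : all (leq 1) (a :: al) by rewrite /= a0.
have d0 N al' be' := @defect_eq0 al' be' N.
have := d0 0%N _ _ aal0 be0; have := d0 0%N _ _ al0 bbe0.
have := d0 0%N _ _ al0 be0; have := d0 0%N _ _ aal0 bbe0.
rewrite /defect => /eqP + /eqP + /eqP + /eqP.
rewrite !subr_eq0 => /eqP e1 /eqP e2 /eqP e3 /eqP e4.
rewrite qsum_sdstarS// e1 e2 e3 e4 !qsum_sstar//.
have := sstarS al 0 a0; have := sstarS be 0 b0; rewrite !sstar0.
move=> /eqP + /eqP; rewrite ![0 == _]eq_sym !addr_eq0 => /eqP-> /eqP->.
by rewrite !invr1 !expr1n natrD; ring.
Qed.

End QuasiShuffle.

(** * Connected sums *)

Section ConnectedSums.
Variable R : realType.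
Implicit Types (d : nat -> R) (mu nu : seq nat).

(** The Beta integral of s^b (1 - s)^n over [0, 1]. *)
Definition beta n b : R := n`!%:R * b`!%:R / (n + b).+1`!%:R.

Lemma beta_ge0 n b : 0 <= beta n b.
Proof. by rewrite divr_ge0 ?mulr_ge0. Qed.

Lemma betaC n b : beta n b = beta b n.
Proof. by rewrite /beta addnC [_ * _`!%:R]mulrC. Qed.

Lemma factS_neq0 n : (n`!)%:R != 0 :> R.
Proof. by rewrite pnatr_eq0 -lt0n fact_gt0. Qed.

Lemma betaSr n b : (n + b).+2%:R * beta n b.+1 = b.+1%:R * beta n b.
Proof.
have h (x y z t u : R) : x != 0 -> y != 0 ->
  y * (t * (u * z) / (y * x)) = u * (t * z / x) by move=> *; field; apply/andP.
rewrite /beta addnS [(n + b).+2`!]factS [b.+1`!]factS.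
by rewrite (natrM _ (n + b).+2) (natrM _ b.+1) h// factS_neq0.
Qed.

Lemma beta_pascal n b : beta n b = beta n.+1 b + beta n b.+1.
Proof.
have nz : (n + b).+2%:R != 0 :> R by rewrite pnatr_eq0.
apply: (mulfI nz); rewrite mulrDr betaSr [beta n.+1 b]betaC addnC betaSr.
by rewrite [beta b n]betaC -mulrDl -natrD addnS addSn addnC.
Qed.

(** The right side is a difference in b, ready to telescope in [beta_sum_div]. *)
Lemma beta_div n b :
  b.+1%:R^-1 * beta n b.+1 = n.+1%:R^-1 * (beta n b - beta n b.+1).
Proof.
rewrite [beta n b]beta_pascal addrK.
have e : n.+1%:R * beta n b.+1 = b.+1%:R * beta n.+1 b.
  apply: (addrI (b.+1%:R * beta n b.+1)).
  rewrite -mulrDl -natrD -mulrDr [beta n b.+1 + _]addrC -beta_pascal -betaSr.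
  by rewrite addnC addnS addSn.
have nz k : k.+1%:R != 0 :> R by rewrite pnatr_eq0.
by apply: (mulfI (nz n)); apply: (mulfI (nz b)); rewrite mulrCA !mulVKf.
Qed.

Lemma beta0 b : beta 0 b = b.+1%:R^-1.
Proof.
by rewrite /beta add0n mul1r factS natrM invfM mulrCA mulfV ?mulr1//.
Qed.

Lemma beta_cvg n : beta n @ \oo --> (0 : R).
Proof.
apply: (squeeze_cvgr (f := cst 0) (h := @sequences.harmonic R)).
- near=> b; rewrite beta_ge0 /= -beta0.
  elim: n => // n; apply: le_trans.
  by rewrite [leRHS]beta_pascal lerDl beta_ge0.
- exact: cvg_cst.
- exact: cvg_harmonic.
Unshelve. all: by end_near. Qed.

Lemma nneseries_telescope (v : nat -> R) : v @ \oo --> (0 : R) ->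
  (\sum_(n <oo) (v n - v n.+1)%:E = (v 0)%:E)%E.
Proof.
move=> v0; apply: nneseries_cvg.
have -> : series (fun n => v n - v n.+1) = fun n => v 0 - v n.
  apply/funext; elim=> [|n IHn]; first by rewrite /series/= big_geq// subrr.
  by rewrite seriesSr IHn; ring.
by rewrite -[X in _ --> X]subr0; apply: cvgB => //; exact: cvg_cst.
Qed.

Lemma beta_sum_div n a :
  (\sum_(i <oo) ((a + i).+1%:R^-1 * beta n (a + i).+1)%:E
   = (n.+1%:R^-1 * beta n a)%:E)%E.
Proof.
rewrite -[in RHS](addn0 a).
rewrite -(@nneseries_telescope (fun i => n.+1%:R^-1 * beta n (a + i))).
  by apply: eq_eseriesr => i _; rewrite beta_div mulrBr addnS.
rewrite -[X in _ --> X](mulr0 n.+1%:R^-1); apply: cvgMl_tmp.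
apply: (@cvg_comp _ _ _ (addn a) (beta n)); first exact: cvg_addnl.
exact: beta_cvg.
Qed.

Lemma beta_sum m b :
  (\sum_(j <oo) (beta (m + j) b.+1)%:E = (beta m b)%:E)%E.
Proof.
rewrite -[in RHS](addn0 m).
rewrite -(@nneseries_telescope (fun j => beta (m + j) b)).
  by apply: eq_eseriesr => j _; rewrite addnS [beta (m + j) b]beta_pascal addrAC
    subrr add0r.
under eq_fun do rewrite betaC.
apply: (@cvg_comp _ _ _ (addn m) (beta b)); first exact: cvg_addnl.
exact: beta_cvg.
Qed.

Definition conn d a : \bar R := \sum_(n <oo) (d n * beta n a)%:E.

(** A factor 1/(n+1) on the side of n becomes a new summation index a + i + 1 on the other side, by
    [beta_sum_div] and an interchange of nonnegative sums. *)
Lemma conn_div d a : (forall n, 0 <= d n) ->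
  conn (fun n => n.+1%:R^-1 * d n) a =
  (\sum_(i <oo) ((a + i).+1%:R^-1)%:E * conn d (a + i).+1)%E.
Proof.
move=> d0; transitivity (\sum_(n <oo) \sum_(i <oo)
    ((a + i).+1%:R^-1 * (d n * beta n (a + i).+1))%:E)%E.
  apply: eq_eseriesr => n _.
  rewrite mulrAC mulrC EFinM -beta_sum_div -nneseriesZl; last first.
    by move=> i _; rewrite lee_fin mulr_ge0 ?beta_ge0.
  by apply: eq_eseriesr => i _; rewrite -EFinM mulrCA.
rewrite nneseries_interchange; last first.
  by move=> n i; rewrite lee_fin !mulr_ge0 ?beta_ge0.
apply: eq_eseriesr => i _; rewrite -nneseriesZl//.
by move=> n _; rewrite lee_fin mulr_ge0 ?beta_ge0.
Qed.

(** Partial summation on the side of n lowers the other argument by one: interchange the sums and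
    apply [beta_sum]. *)
Lemma conn_sum d b : (forall n, 0 <= d n) ->
  conn (fun n => \sum_(m < n.+1) d m) b.+1 = conn d b.
Proof.
move=> d0; have p0 n m : 0 <= d m * beta n b.+1 by rewrite mulr_ge0 ?beta_ge0.
(* The inner finite sum becomes a series with zero terms past n, which allows the interchange. *)
transitivity (\sum_(n <oo) \sum_(m <oo)
    (if (m <= n)%N then (d m * beta n b.+1)%:E else 0))%E.
  apply: eq_eseriesr => n _; rewrite (nneseries_split 0 n.+1)/=; last first.
    by move=> m *; case: ifP => *; rewrite ?lee_fin ?p0.
  rewrite [X in (_ + X)%E]eseries0 ?adde0; last first.
    by move=> m; rewrite add0n => nm _; rewrite leqNgt nm.
  rewrite mulr_suml -sumEFin big_mkord; apply: eq_bigr => m _.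
  by rewrite -ltnS ltn_ord.
rewrite nneseries_interchange; last first.
  by move=> n m; case: ifP => *; rewrite ?lee_fin ?p0.
apply: eq_eseriesr => m _; rewrite EFinM -beta_sum -nneseriesZl; last first.
  by move=> j _; rewrite lee_fin beta_ge0.
rewrite (nneseries_split 0 m)/=; last first.
  by move=> n *; case: ifP => *; rewrite ?lee_fin ?p0.
rewrite big1_seq ?add0e; last first.
  move=> n; rewrite mem_index_iota => /andP[_ /andP[_ nm]].
  by rewrite leqNgt nm.
rewrite -nneseries_addn; last by move=> n; case: ifP => *; rewrite ?lee_fin ?p0.
by apply: eq_eseriesr => j _; rewrite leq_addl addnC EFinM.
Qed.

End ConnectedSums.

(** * Refinements and zeta values *)

Section Refinements.
Variable R : realType.
Implicit Types (mu nu : seq nat).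

(** The nested sum over a < n_1 < ... < n_p. The weight at the last index is a parameter, so that
    1/n_p can stand for the raised last exponent. *)
Fixpoint zeta_above (w : nat -> \bar R) (k : seq nat) (a : nat) : \bar R :=
  if k is i :: k' then
    (\sum_(j <oo) ((a + j).+1%:R^-1 ^+ i)%:E * zeta_above w k' (a + j).+1)%E
  else w a.

Lemma zeta_above_ge0 w k a : (forall b, 0 <= w b)%E ->
  (0 <= zeta_above w k a)%E.
Proof.
move=> w0; elim: k a => //= i k IHk a; apply: nneseries_ge0 => j _ _.
by rewrite mule_ge0// lee_fin exprn_ge0.
Qed.

Lemma zeta_aboveS w i k a : (forall b, 0 <= w b)%E ->
  zeta_above w (i :: k) a = ((a.+1%:R^-1 ^+ i)%:E * zeta_above w k a.+1
    + zeta_above w (i :: k) a.+1)%E.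
Proof.
move=> w0; have z0 j : (0 <= ((a + j).+1%:R^-1 ^+ i)%:E
    * zeta_above w k (a + j).+1)%E.
  by rewrite mule_ge0 ?zeta_above_ge0// lee_fin exprn_ge0.
rewrite [LHS]/= nneseries_recl// addn0; congr (_ + _)%E.
rewrite -[1%N]add0n -nneseries_addn//.
by apply: eq_eseriesr => j _; rewrite add0n addn1 addnS.
Qed.

(** The constant [c] collects the factors of the indices already split off. *)
Lemma esum_zeta_above k a (c : R) : 0 <= c ->
  (\esum_(n in [set n : seq nat | size n = size k /\ path ltn a n])
     (c * \prod_(p <- zip n k) (p.1%:R ^+ p.2)^-1)%:E
   = c%:E * zeta_above (cst 1) k a)%E.
Proof.
elim: k a c => [|i k IHk] a c c0.
  rewrite (_ : [set n | _] = [set [::]]); last first.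
    apply/seteqP; split => [n [/size0nil ->]//|n ->]; by split.
  by rewrite esum_set1 ?big_nil ?mulr1 ?mule1// lee_fin.
pose J j := [set n : seq nat | size n = size k /\ path ltn (a + j).+1 n].
rewrite (reindex_esum ([set: nat] `*`` J) _
  (fun p : nat * seq nat => (a + p.1).+1 :: p.2)); last first.
  split.
  - move=> [j n] [_ [/= ns np]]; split; rewrite /= ?ns// np andbT.
    by rewrite ltnS leq_addr.
  - by move=> [j n] [j' n'] _ _ /= [/addnI -> ->].
  - move=> [|m n] [//= [ns] /andP[am mn]]; exists ((m - a.+1)%N, n) => /=.
      by split => //; rewrite /J /= -addSn subnKC.
    by rewrite -addSn subnKC.
rewrite -(@esum_esum _ _ _ _ _ (fun j n => (c * \prod_(p <- zip
  ((a + j).+1 :: n) (i :: k)) (p.1%:R ^+ p.2)^-1)%:E)); last first.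
  by move=> j n _ _; rewrite lee_fin mulr_ge0// prodr_ge0.
rewrite /= -nneseriesZl; last first.
  by move=> j _; rewrite mule_ge0 ?zeta_above_ge0// lee_fin exprn_ge0.
rewrite nneseries_esumT; last first.
  by move=> j; rewrite !mule_ge0 ?zeta_above_ge0// lee_fin// exprn_ge0.
apply: eq_esum => j _; rewrite muleA -EFinM -IHk; last first.
  by rewrite mulr_ge0// exprn_ge0.
by apply: eq_esum => n _; rewrite big_cons /= mulrA exprVn.
Qed.

Lemma zetaE k : zeta R k = fine (zeta_above (cst 1%E) k 0).
Proof.
rewrite /zeta -[zeta_above _ _ _]mul1e -esum_zeta_above//.
by congr fine; apply: eq_esum => n _; rewrite mul1r.
Qed.

Definition inv_weight (a : nat) : \bar R := (a%:R^-1)%:E.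

Lemma zeta_above_incr_last mu a : mu != [::] ->
  zeta_above (cst 1%E) (incr_nth mu (size mu).-1) a =
  zeta_above inv_weight mu a.
Proof.
elim: mu a => // i [|j mu] IHmu a _.
  by apply: eq_eseriesr => b _; rewrite mule1 -EFinM exprSr.
by apply: eq_eseriesr => b _; congr (_ * _)%E; exact: IHmu.
Qed.

(** Raising the first entry of [k :: mu] by one either puts a new part 1 in front of a refinement or
    enlarges its first part. *)
Fixpoint refinements mu : seq (seq nat) :=
  if mu is k :: mu' then
    iter k.-1
      (fun l => [seq 1%N :: nu | nu <- l] ++ [seq incr_nth nu 0 | nu <- l])
      [seq 1%N :: nu | nu <- refinements mu']
  else [:: [::]].

Lemma refinements_raise k mu : (0 < k)%N ->
  refinements (k.+1 :: mu) = [seq 1%N :: nu | nu <- refinements (k :: mu)]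
    ++ [seq incr_nth nu 0 | nu <- refinements (k :: mu)].
Proof. by case: k. Qed.

Lemma refinements_neq0 k mu nu : (0 < k)%N ->
  nu \in refinements (k :: mu) -> nu != [::].
Proof.
case: k => // k _; elim: k nu => [|k IHk] nu; first by move=> /mapP[? _ ->].
by rewrite refinements_raise// mem_cat => /orP[] /mapP[[|i s] _ ->].
Qed.

(** Induction on the entries, one unit at a time. The empty word with a = 0 is excluded: the left
    side diverges there, while [inv_weight 0] is 0. *)
Lemma conn_mom mu a : all (leq 1) mu -> (0 < a)%N || (mu != [::]) ->
  conn (fun n => mom R mu n 0) a =
  (\sum_(nu <- refinements mu) zeta_above inv_weight nu a)%E.
Proof.
have w0 b : (0 <= inv_weight b)%E by rewrite lee_fin.
have m0 mu' n : 0 <= mom R mu' n 0 by exact: nonneg_mom.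
elim: mu a => [|k mu IHmu] a.
  case: a => // a _ _; rewrite big_seq1 /= /inv_weight -beta0 -beta_sum.
  by apply: eq_eseriesr => n _; rewrite mul1r.
move=> /andP[]; case: k => // k _ mu0 _; elim: k a => [|k IHk] a.
  rewrite (_ : conn _ _ =
      conn (fun n => n.+1%:R^-1 * mom R mu n 0) a); last first.
    by apply: eq_eseriesr => n _; rewrite /= prepend_col0.
  rewrite conn_div// big_map /= -nneseries_sum; last first.
    by move=> nu j _; rewrite mule_ge0 ?zeta_above_ge0// lee_fin.
  apply: eq_eseriesr => j _; rewrite IHmu// ge0_sume_distrr//.
  by move=> nu _; exact: zeta_above_ge0.
(* Column 0 of [raise] is an average: [conn_div] introduces the index a + j + 1, and [conn_sum]
   lowers the argument back to a + j. *)
rewrite (_ : conn _ _ = conn (fun n => n.+1%:R^-1 *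
    (\sum_(m < n.+1) mom R (k.+1 :: mu) m 0)) a); last first.
  by apply: eq_eseriesr => n _; rewrite mom_raise// raise_col0.
rewrite conn_div; last by move=> n; apply: sumr_ge0 => m _.
under eq_eseriesr do
  rewrite (conn_sum (d := fun m => mom R (k.+1 :: mu) m 0))// IHk.
rewrite (@refinements_raise k.+1)// big_cat !big_map /= -big_split /=.
transitivity (\sum_(nu <- refinements (k.+1 :: mu)) \sum_(j <oo)
    ((a + j).+1%:R^-1)%:E * zeta_above inv_weight nu (a + j))%E.
  rewrite -nneseries_sum; last first.
    by move=> nu j _; rewrite mule_ge0 ?zeta_above_ge0// lee_fin.
  apply: eq_eseriesr => j _; rewrite ge0_sume_distrr//.
  by move=> nu _; exact: zeta_above_ge0.
apply: eq_big_seq => nu /(refinements_neq0 (ltn0Sn k)).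
case: nu => // i nu _ /=.
rewrite -nneseriesD; last 2 first.
- by move=> j _ _; rewrite mule_ge0 ?(zeta_above_ge0 (i :: nu))// lee_fin.
- by move=> j _ _; rewrite mule_ge0 ?zeta_above_ge0// lee_fin exprn_ge0.
apply: eq_eseriesr => j _; rewrite -[X in (_ * X)%E]/(zeta_above _ (i :: nu) _).
(* The first index of the refinement is at least a + j + 1. Equality increments its first entry;
   strict inequality prepends a 1. *)
rewrite zeta_aboveS// ge0_muleDr; last 2 first.
- by rewrite mule_ge0 ?zeta_above_ge0// lee_fin exprn_ge0.
- by rewrite zeta_above_ge0.
by rewrite addeC muleA -EFinM -exprS expr1.
Qed.

(** As beta n 0 = 1/(n+1), this is [conn_mom] at a = 0. The total is finite, so each nonnegative
    summand is finite and [fine] commutes with the sum. *)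
Lemma dstar_refinements mu : all (leq 1) mu -> mu != [::] ->
  dstar R mu 0 =
  \sum_(nu <- refinements mu) zeta R (incr_nth nu (size nu).-1).
Proof.
move=> mu0 mun; have w0 b : (0 <= inv_weight b)%E by rewrite lee_fin.
have z0 nu b : (0 <= zeta_above inv_weight nu b)%E by exact: zeta_above_ge0.
have lE : logsum (mom R mu) 0 =
    (\sum_(nu <- refinements mu) zeta_above inv_weight nu 0)%E.
  rewrite -conn_mom// ?mun ?orbT//.
  by apply: eq_eseriesr => n _; rewrite betaC beta0.
have := logsum_mom_lty R 0 mun; rewrite /dstar lE.
rewrite -ge0_fin_numE ?sume_ge0// => /sum_fin_numP zfin.
rewrite !big_seq -sum_fine; last by move=> nu nur; exact: zfin.
apply: eq_bigr => nu nur; rewrite zetaE zeta_above_incr_last//.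
case: mu mun nur mu0 {lE zfin} => // k mu _ /[swap] /andP[k0 _].
exact: refinements_neq0.
Qed.

(** * Refinement through partial sums, with 0 and the total included *)

Fixpoint psum (s : seq nat) (x : nat) : bool :=
  if s is k :: s' then (x == 0)%N || (k <= x)%N && psum s' (x - k)
  else x == 0%N.

Lemma psum0 s : psum s 0.
Proof. by case: s. Qed.

Lemma psum_1cons s x : psum (1%N :: s) x.+1 = psum s x.
Proof. by rewrite /= subn1. Qed.

Lemma psum_consS k s x : psum (k.+2 :: s) x.+2 = psum (k.+1 :: s) x.+1.
Proof. by rewrite /= ltnS subSS. Qed.

Lemma mem_refinements mu nu : all (leq 1) mu ->
  (nu \in refinements mu) <->
  [/\ all (leq 1) nu, sumn nu = sumn mu & forall x, psum mu x -> psum nu x].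
Proof.
elim: mu nu => [|k mu IHmu] nu.
  rewrite inE; split=> [/eqP ->//|[]]; case: nu => // -[|j] nu //=.
move=> /andP[]; case: k => // k _ mu0; elim: k nu => [|k IHk] nu.
  split=> [/mapP[nu' /IHmu[//|nu0 sE psE] ->]|].
    by split=> //=; [rewrite sE|case=> // x; rewrite ?psum_1cons; exact: psE].
  move=> []; case: nu => // j nu /= /andP[j0 nu0] sE psE.
  (* The partial sum 1 of [1 :: mu] must occur in the refinement, which forces its first entry. *)
  have j1 : j = 1%N.
    apply/eqP; rewrite eqn_leq j0 andbT.
    by have := psE 1%N; rewrite /= subnn psum0 => /(_ isT)/andP[].
  move: sE psE; rewrite {}j1 => -[sE] psE; apply/map_f/IHmu => //; split=> // x.
  by have := psE x.+1; rewrite /= !subn1.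
rewrite (@refinements_raise k.+1)// mem_cat; split.
  move=> /orP[] /mapP[nu' /IHk[nu0 sE psE] ->].
    split=> //; first by rewrite /= sE.
    case=> [//|[//|x]]; rewrite psum_consS psum_1cons; exact: psE.
  case: nu' nu0 sE psE => // j nu' /= /andP[j0 nu0] sE psE.
  case: j j0 sE psE => // j _ sE psE.
  split; [exact: nu0|by rewrite /= addSn sE|].
  case=> [//|[//|x]]; have := psE x.+1; rewrite /= !ltnS !subSS; exact.
(* A first entry 1 belongs to the prepended half, a larger one to the incremented half. *)
move=> []; case: nu => // -[//|[|j]] nu /= nu0 sE psE.
  apply/orP; left; apply/map_f/IHk; split=> //; first by case: sE.
  case=> [_|x h]; first exact: psum0.
  by have := psE x.+2; rewrite /= subn1; apply; move: h; rewrite /= ltnS subSS.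
apply/orP; right; apply/mapP; exists (j.+1 :: nu) => //; apply/IHk; split=> //.
  by move: sE; rewrite /= !addSn => -[->].
by case=> [//|x h]; have := psE x.+2; rewrite /= ltnS subSS; apply; move: h;
  rewrite /= ltnS subSS.
Qed.

Lemma uniq_refinements mu : all (leq 1) mu -> uniq (refinements mu).
Proof.
elim: mu => [//|k mu IHmu] /= /andP[]; case: k => // k _ mu0.
elim: k => [|k IHk]; first by rewrite /= map_inj_uniq ?IHmu// => ? ? [].
rewrite [iter _ _ _](@refinements_raise k.+1)// cat_uniq.
rewrite map_inj_uniq ?[uniq _]IHk; last by move=> ? ? [].
(* [incr_nth] at 0 sends both [[::]] and [[:: 0]] to [[:: 1]], so injectivity is claimed only on the
   nonempty words of the list. *)
rewrite map_inj_in_uniq ?[uniq _]IHk ?andbT; last first.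
  by move=> [|i s] [|j t] /(refinements_neq0 (ltn0Sn k)) h
    /(refinements_neq0 (ltn0Sn k)) h' //= [-> ->].
(* The halves are disjoint: an incremented word starts with an entry at least 2. *)
apply/hasPn => s /mapP[nu /[dup] /(refinements_neq0 (ltn0Sn k)) nun].
move=> /mem_refinements[//|nu0 _ _ ->]; apply/mapP => -[nu' _].
by case: nu nun nu0 => // -[].
Qed.

Lemma psumP s x :
  reflect (exists2 k, (k <= size s)%N & sumn (take k s) = x) (psum s x).
Proof.
elim: s x => [|i s IHs] x /=.
  by apply: (iffP eqP) => [->|[k _ <-]//]; exists 0%N.
apply: (iffP orP) => [[/eqP ->|/andP[ix /IHs[k ks kE]]]|[[|k] ks <-]].
- by exists 0%N.
- by exists k.+1; rewrite //= kE subnKC.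
- by left.
- by right; rewrite /= leq_addr addKn; apply/IHs; exists k.
Qed.

(** Partial sums of positive entries increase strictly, so bounds on k become bounds on x. *)
Lemma proper_sumsE (mu : mindex) x :
  proper_sums mu x <-> (0 < x < sumn mu)%N /\ psum mu x.
Proof.
have /andP[_ mu0] := mi_valid mu; rewrite /proper_sums; split.
  move=> [k /= /andP[k0 kmu] <-]; split; last first.
    by apply/psumP; exists k => //; exact: ltnW.
  have tk : all (leq 1) (take k mu) by apply/allP => y /mem_take; exact/allP.
  have dk : all (leq 1) (drop k mu) by apply/allP => y /mem_drop; exact/allP.
  rewrite (leq_trans _ (size_le_sumn tk)) ?size_takel ?(ltnW kmu)//=.
  rewrite -{2}(cat_take_drop k mu) sumn_cat -addn1 leq_add2l.
  by rewrite (leq_trans _ (size_le_sumn dk))// size_drop subn_gt0.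
move=> [/andP[x0 xmu] /psumP[k kmu kE]]; exists k => //=.
rewrite lt0n ltn_neqAle kmu andbT; apply/andP; split.
  by apply: contraTneq x0 => k0; rewrite -kE k0 take0.
by apply: contraTneq xmu => k0; rewrite -kE k0 take_size ltnn.
Qed.

Lemma psum_sumn s : psum s (sumn s).
Proof. by apply/psumP; exists (size s); rewrite ?take_size. Qed.

Lemma psum_le s x : psum s x -> (x <= sumn s)%N.
Proof.
move=> /psumP[k _ <-].
by rewrite -{2}(cat_take_drop k s) sumn_cat leq_addr.
Qed.

Lemma refinesE (nu mu : mindex) : refines nu mu <-> val nu \in refinements mu.
Proof.
have /andP[_ mu0] := mi_valid mu; have /andP[_ nu0] := mi_valid nu.
rewrite mem_refinements//; split=> [[wE sub]|[_ wE sub]]; split=> //.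
  move=> x xmu; have [->|x0] := posnP x; first exact: psum0.
  have := psum_le xmu; rewrite leq_eqVlt => /orP[/eqP ->|x1].
    by rewrite -[sumn mu]wE; exact: psum_sumn.
  by have /proper_sumsE[] : proper_sums nu x
    by apply: sub; apply/proper_sumsE; rewrite x0 x1.
move=> x /proper_sumsE[xb /sub xmu]; apply/proper_sumsE.
by rewrite [sumn nu]wE.
Qed.

End Refinements.

(** * Extension by linearity *)

Section Linearity.
Variable R : realType.
Implicit Types (v w : V) (mu : mindex).

(** Allows vectors with different supports to be summed over one common list. *)
Lemma dom_sum_widen (M : zmodType) (F : rat -> mindex -> M) v (s : seq mindex) :
  (forall mu, F 0 mu = 0) -> uniq s -> {subset dom v <= s} ->
  \sum_(mu <- dom v) F (coeff mu v) mu = \sum_(mu <- s) F (coeff mu v) mu.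
Proof.
move=> F0 us vs; rewrite [RHS](bigID (mem (dom v)))/= [X in _ + X]big1 ?addr0.
  rewrite -[RHS]big_filter; apply: perm_big.
  apply: uniq_perm; rewrite ?uniq_dom ?filter_uniq//.
  by move=> mu; rewrite mem_filter andb_idr//; exact: vs.
by move=> mu /coeff_outdom ->; rewrite F0.
Qed.

Lemma zeta_plusD v w : zeta_plus R (v + w) = zeta_plus R v + zeta_plus R w.
Proof.
pose F c mu := ratr c * zeta R (incr_nth mu (size mu).-1).
have F0 mu : F 0 mu = 0 by rewrite /F raddf0 mul0r.
pose s := undup (dom v ++ dom w ++ dom (v + w)).
have us : uniq s by exact: undup_uniq.
rewrite /zeta_plus !(dom_sum_widen (F := F) F0 us).
- rewrite -big_split; apply: eq_bigr => mu _.
  by rewrite coeffD /F raddfD mulrDl.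
- by move=> mu; rewrite mem_undup !mem_cat => ->; rewrite orbT.
- by move=> mu; rewrite mem_undup !mem_cat => ->.
- by move=> mu; rewrite mem_undup !mem_cat => ->; rewrite !orbT.
Qed.

Lemma zeta_plusZ (c : rat) v : zeta_plus R (c *: v) = ratr c * zeta_plus R v.
Proof.
pose F c mu := ratr c * zeta R (incr_nth mu (size mu).-1).
have F0 mu : F 0 mu = 0 by rewrite /F raddf0 mul0r.
rewrite /zeta_plus (dom_sum_widen (F := F) F0 (uniq_dom v)); last first.
  exact: domZ_subset.
by rewrite mulr_sumr; apply: eq_bigr => mu _; rewrite coeffZ /F rmorphM mulrA.
Qed.

Lemma fgliftE (f : mindex -> V) v :
  fglift f v = \sum_(mu <- dom v) coeff mu v *: f mu.
Proof. by rewrite -{1}(Freeg_dom v) fglift_Freeg /prelift big_map. Qed.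

Lemma fgliftZ (f : mindex -> V) (c : rat) v :
  fglift f (c *: v) = c *: fglift f v.
Proof.
rewrite !fgliftE.
rewrite (@dom_sum_widen _ (fun a mu => a *: f mu) _ _ _ (uniq_dom v)).
- by rewrite scaler_sumr; apply: eq_bigr => mu _; rewrite coeffZ scalerA.
- by move=> mu; rewrite scale0r.
- exact: domZ_subset.
Qed.

Lemma fgliftD (f : mindex -> V) v w :
  fglift f (v + w) = fglift f v + fglift f w.
Proof.
have fB := @lift_is_additive _ _ _ f.
have f0 : fglift f 0 = 0 by rewrite -[X in fglift f X](subrr 0) fB subrr.
(* [fB] concerns differences, so v + w is read as v - (0 - w). *)
by rewrite -{1}[w]opprK fB -[- w]add0r fB f0 sub0r opprK.
Qed.

Definition Lambda v : R := zeta_plus R (u (sigma v)).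

Lemma LambdaD v w : Lambda (v + w) = Lambda v + Lambda w.
Proof. by rewrite /Lambda /sigma fgliftD /u fgliftD zeta_plusD. Qed.

Lemma LambdaZ (c : rat) v : Lambda (c *: v) = ratr c * Lambda v.
Proof. by rewrite /Lambda /sigma fgliftZ /u fgliftZ zeta_plusZ. Qed.

Lemma Lambda0 : Lambda 0 = 0.
Proof. by rewrite -(scale0r (0 : V)) LambdaZ raddf0 mul0r. Qed.

Lemma zeta_plus0 : zeta_plus R 0 = 0.
Proof. by rewrite -(scale0r (0 : V)) zeta_plusZ raddf0 mul0r. Qed.

Lemma zeta_plus_basis mu :
  zeta_plus R (basis mu) = zeta R (incr_nth mu (size mu).-1).
Proof.
by rewrite /zeta_plus /basis domU1 big_seq1 coeffU eqxx mulr1 rmorph1 mul1r.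
Qed.

Lemma sum_refinesE mu (f : seq nat -> R) :
  \sum_(nu \in [set nu | refines nu mu]) f nu = \sum_(s <- refinements mu) f s.
Proof.
have /andP[mun mu0] := mi_valid mu.
rewrite (fsbig_seq _ _ (uniq_refinements mu0)); apply/esym.
apply: (reindex_fsbig mi_seq); split.
- by move=> nu /refinesE.
- by move=> nu nu' _ _; exact: val_inj.
- move=> s /= smu.
  have sv : is_mindex s.
    have /mem_refinements[//|s0 _ _] := smu; rewrite /is_mindex s0 andbT.
    case: (mi_seq mu) mun mu0 smu => // k t _ /andP[k0 _].
    exact: refinements_neq0.
  by exists (MIndex sv) => //; apply/refinesE.
Qed.

Lemma sum_HE (al be : mindex) (f : seq (nat * nat) -> R) :
  \sum_(M \in [set: H al be]) f (val M) = \sum_(M <- matrices al be) f M.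
Proof.
have /andP[_ al0] := mi_valid al; have /andP[_ be0] := mi_valid be.
rewrite (fsbig_seq _ _ (uniq_matrices al0 be0)); apply/esym.
apply: (reindex_fsbig val); split.
- by move=> M _ /=; rewrite mem_matrices//; exact: (valP M).
- by move=> M M' _ _; exact: val_inj.
- by move=> M /=; rewrite mem_matrices// => MH; exists (exist _ M MH).
Qed.

(** [sigma] supplies the sign, and [u] the sum over refinements computed by [dstar_refinements]. *)
Lemma Lambda_basis mu : Lambda (basis mu) = sdstar R mu 0.
Proof.
have /andP[mun mu0] := mi_valid mu.
rewrite /Lambda /sigma liftU scale1r /u fgliftZ zeta_plusZ liftU scale1r.
rewrite /sdstar dstar_refinements// -(sum_refinesE mu
  (fun nu => zeta R (incr_nth nu (size nu).-1))).
rewrite rmorphXn rmorphN1; congr (_ * _).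
rewrite !fsbig_finite//; try exact: finite_refinements.
rewrite (big_morph _ zeta_plusD zeta_plus0).
by apply: eq_bigr => nu _; rewrite zeta_plus_basis.
Qed.

Lemma Lambda_harmonic_mindex (al be : mindex) :
  Lambda (harmonic_mindex al be) = 0.
Proof.
have /andP[aln al0] := mi_valid al; have /andP[ben be0] := mi_valid be.
rewrite -(qsum_sdstar0 R al0 be0 aln ben) /qsum.
rewrite -(@sum_HE al be (fun M => sdstar R (column_sums M) 0)) /harmonic_mindex.
rewrite !fsbig_finite//; try exact: finite_H.
rewrite (big_morph _ LambdaD Lambda0).
by apply: eq_bigr => M _; rewrite Lambda_basis.
Qed.

Lemma Lambda_harmonic v w : Lambda (harmonic v w) = 0.
Proof.
rewrite /harmonic fgliftE (big_morph _ LambdaD Lambda0) big1// => mu _.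
rewrite LambdaZ fgliftE (big_morph _ LambdaD Lambda0) big1 ?mulr0// => nu _.
by rewrite LambdaZ Lambda_harmonic_mindex mulr0.
Qed.

End Linearity.

Theorem corollary5p5 (R : realType) :
  (u \o sigma) @` VstarV `<=` ker_zeta_plus R /\
  (forall v w : V, zeta_plus R (u (sigma (harmonic v w))) = 0).
Proof.
split=> [_ [_ [s ->] <-]|v w]; last exact: Lambda_harmonic.
rewrite /ker_zeta_plus /= -[LHS]/(Lambda R _).
rewrite (big_morph _ (@LambdaD R) (Lambda0 R)) big1// => t _.
by rewrite LambdaZ Lambda_harmonic mulr0.
Qed.
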